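(* Let $G$ be a torsion-free abelian group, let $A$ be a $G$-graded domain, and let the polynomial ring $A[X]$ have the natural $G\times\mathbb{Z}_{\geq0}$-grading. If $A[X]$ is a graded perinormal domain, then $A$ is a graded perinormal domain.
   Context: A $G$-graded domain is an integral domain $R=\bigoplus_{\alpha\in G}R_\alpha$ with each $R_\alpha$ an additive subgroup and $R_\beta R_\gamma\subseteq R_{\beta+\gamma}$. The natural $G\times\mathbb{Z}_{\ge0}$-grading on $A[X]$ has degree $(g,z)$ component $A_gX^z$ (and is regarded as a $G\times\mathbb{Z}$-grading with zero components in the remaining degrees). The graded quotient field of a graded domain $R$ is $R_H$, where $H$ is the set of nonzero homogeneous elements; $f/g$ (with $f,g$ homogeneous, $g\neq0$) has degree $\deg f-\deg g$. A graded overring of $R$ is a graded subring of $R_H$ containing $R$. $h\text{-Spec}$ denotes the set of graded (homogeneous) prime ideals. A graded maximal ideal is an ideal maximal among proper graded ideals; a graded domain is gr-local if it has exactly one graded maximal ideal. A graded overring $S$ of $R$ satisfies gGD (graded going-down) if whenever $P,Q\in h\text{-Spec}(R)$ and $\tilde Q\in h\text{-Spec}(S)$ with $P\subseteq Q$ and $\tilde Q\cap R=Q$, there exists $\tilde P\in h\text{-Spec}(S)$ with $\tilde P\subseteq\tilde Q$ and $\tilde P\cap R=P$. A graded domain $R$ is a graded perinormal domain if every gr-local graded overring of $R$ satisfying gGD over $R$ is a localization of $R$ (i.e. equals $R_W$ for some multiplicative subset $W$ of $R$). *)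

(* Defs.v *)
From mathcomp Require Import all_boot all_order all_algebra.
From mathcomp Require Import boolp classical_sets.

Set Implicit Arguments.
Unset Strict Implicit.
Unset Printing Implicit Defensive.

Import GRing.Theory.
Local Open Scope classical_set_scope.
Local Open Scope ring_scope.

Definition torsion_free (G : zmodType) : Prop :=
  forall (g : G) (n : nat), (0 < n)%N -> g *+ n = 0 -> g = 0.

(* The sum of a family of additive subgroups: all finite sums of elements
   f g \in c g. *)
Definition sum_comp (G : zmodType) (L : zmodType) (c : G -> set L) : set L :=
  [set x | exists (s : seq G) (f : G -> L),
      (forall g, c g (f g)) /\ x = \sum_(g <- s) f g].

(* A G-grading of the domain R; [grading_span] and [grading_indep] together say
   that R is the direct sum of its components. *)
Record grading (G : zmodType) (R : idomainType) := Grading {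
  comp :> G -> set R;
  grading_zmod : forall g, zmod_closed (mem (comp g));
  grading_mul : forall g h x y,
    comp g x -> comp h y -> comp (g + h) (x * y);
  grading_span : sum_comp comp = setT;
  grading_indep : forall (s : seq G) (f : G -> R), uniq s ->
    (forall g, comp g (f g)) -> \sum_(g <- s) f g = 0 ->
    forall g, g \in s -> f g = 0
}.

(* Below, S is a subring of a commutative ring L whose component of degree g
   is S `&` c g; ideals of S are subsets of L.  For R itself take L = R and
   S = setT, for an overring take L = {fraction R}. *)
Section Ideals.
Variables (G : zmodType) (L : comNzRingType) (c : G -> set L) (S : set L).

Definition is_graded (I : set L) : Prop :=
  I `<=` sum_comp (fun g => I `&` c g).

Record ideal (I : set L) : Prop := Ideal {
  ideal_sub : I `<=` S;
  ideal_zmod : zmod_closed (mem I);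
  ideal_mul : forall a x, S a -> I x -> I (a * x)
}.

Record prime_ideal (P : set L) : Prop := PrimeIdeal {
  prime_is_ideal : ideal P;
  prime_proper : P <> S;
  prime_mul : forall x y, S x -> S y -> P (x * y) -> P x \/ P y
}.

Definition hSpec (P : set L) : Prop := prime_ideal P /\ is_graded P.

Definition proper_graded_ideal (I : set L) : Prop :=
  [/\ ideal I, is_graded I & I <> S].

Definition graded_maximal (M : set L) : Prop :=
  proper_graded_ideal M /\
  forall I, proper_graded_ideal I -> M `<=` I -> I = M.

Definition gr_local : Prop := exists! M, graded_maximal M.

End Ideals.

(* R_W, as a subset of the field of fractions; meaningful when 0 \notin W. *)
Definition localization (R : idomainType) (W : set R) : set {fraction R} :=
  [set x | exists r w, W w /\ x = tofrac r / tofrac w].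

(* 0 is excluded so that R_W embeds in the field of fractions. *)
Definition multiplicative_subset (R : idomainType) (W : set R) : Prop :=
  mulr_closed (mem W) /\ ~ W 0.

Section GradedDomain.
Variables (G : zmodType) (R : idomainType) (gr : grading G R).

Definition nz_homog : set R := [set h | h <> 0 /\ exists g, gr g h].

Definition gr_quotient_field : set {fraction R} := localization nz_homog.

Definition qf_comp (g : G) : set {fraction R} :=
  [set x | exists a b f h, [/\ gr a f, gr b h, h <> 0,
      x = tofrac f / tofrac h & g = a - b]].

Record graded_overring (S : set {fraction R}) : Prop := GradedOverring {
  overring_subring : subring_closed (mem S);
  overring_base : range (@tofrac R) `<=` S;
  overring_qf : S `<=` gr_quotient_field;
  overring_graded : is_graded qf_comp S
}.

Definition contraction (I : set {fraction R}) : set R := @tofrac R @^-1` I.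

Definition gGD (S : set {fraction R}) : Prop :=
  forall (P Q : set R) (Q' : set {fraction R}),
    hSpec gr setT P -> hSpec gr setT Q -> hSpec qf_comp S Q' ->
    P `<=` Q -> contraction Q' = Q ->
    exists P' : set {fraction R},
      [/\ hSpec qf_comp S P', P' `<=` Q' & contraction P' = P].

Definition graded_perinormal : Prop :=
  forall S : set {fraction R},
    graded_overring S -> gr_local qf_comp S -> gGD S ->
    exists W : set R, multiplicative_subset W /\ S = localization W.

End GradedDomain.

Section PolyGrading.
Variables (G : zmodType) (A : idomainType) (gr : grading G A).

Definition poly_comp (d : G * int) : set {poly A} :=
  match d.2 with
  | Posz n => [set p | exists2 a, gr d.1 a & p = a *: 'X^n]
  | Negz _ => [set 0]
  end.

Lemma gr0 g : gr g 0.
Proof. by have [/set_mem] := grading_zmod gr g. Qed.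

Lemma grB g x y : gr g x -> gr g y -> gr g (x - y).
Proof.
move=> /mem_set hx /mem_set hy; have [_ h] := grading_zmod gr g.
by apply: set_mem; exact: h.
Qed.

Lemma poly_comp_zmod d : zmod_closed (mem (poly_comp d)).
Proof.
case: d => g [n|n]; split; rewrite ?in_setE.
- by exists 0; [exact: gr0 | rewrite scale0r].
- move=> x y; rewrite !in_setE => -[a ha ->] [b hb ->].
  by exists (a - b); [exact: grB | rewrite scalerBl].
- by [].
- by move=> x y; rewrite !in_setE => -> ->; rewrite /poly_comp /= subr0.
Qed.

Lemma poly_comp_mul d e x y :
  poly_comp d x -> poly_comp e y -> poly_comp (d + e) (x * y).
Proof.
have z d' : poly_comp d' 0.
  by have [/set_mem] := poly_comp_zmod d'.
case: d e => g [n|n] [h [m|m]]; rewrite {1 2}/poly_comp /=; last 3 first.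
- by move=> _ ->; rewrite mulr0.
- by move=> -> _; rewrite mul0r.
- by move=> -> _; rewrite mul0r.
move=> [a ha ->] [b hb ->]; exists (a * b); first exact: grading_mul.
by rewrite -scalerAl -scalerAr scalerA exprD.
Qed.

Lemma poly_comp_coef g (z : int) p (i : nat) :
  poly_comp (g, z) p -> gr g p`_i /\ (p`_i != 0 -> z = i).
Proof.
case: z => n; last first.
  by move=> ->; rewrite coef0 eqxx; split=> //; exact: gr0.
move=> [a ha ->]; rewrite coefZ coefXn; case: eqP => [->|_].
  by rewrite mulr1.
by rewrite mulr0 eqxx; split=> //; exact: gr0.
Qed.

Lemma poly_comp_span : sum_comp poly_comp = setT.
Proof.
apply/seteqP; split=> // p _.
have /choice[u hu] : forall n : nat, exists u : seq G * (G -> A),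
    (forall g, gr g (u.2 g)) /\ p`_n = \sum_(g <- u.1) u.2 g.
  move=> n; have : sum_comp gr p`_n by rewrite grading_span.
  by move=> [s [f [hf ->]]]; exists (s, f).
exists [seq (g, Posz n) | n <- iota 0 (size p), g <- (u n).1].
exists (fun d => if d.2 is Posz n then (u n).2 d.1 *: 'X^n else 0); split.
  by case=> g [n|n] //=; exists ((u n).2 g) => //; apply: (hu n).1.
rewrite big_allpairs_dep /= -{1}[p]coefK poly_def.
rewrite -(big_mkord xpredT (fun i => p`_i *: 'X^i)) /index_iota subn0.
apply: eq_bigr => n _; rewrite (hu n).2 scaler_suml.
by apply: eq_bigr.
Qed.

Lemma poly_comp_indep (s : seq (G * int)) (f : G * int -> {poly A}) :
  uniq s -> (forall d, poly_comp d (f d)) -> \sum_(d <- s) f d = 0 ->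
  forall d, d \in s -> f d = 0.
Proof.
move=> us hf fs0 [g z] ds; apply/polyP => i; rewrite coef0.
have [//|nz] := eqVneq ((f (g, z))`_i) 0.
have zi : z = i := (poly_comp_coef i (hf (g, z))).2 nz.
pose t := [seq d.1 | d <- s & d.2 == Posz i].
have ut : uniq t.
  rewrite map_inj_in_uniq ?filter_uniq // => -[a b] [a' b'].
  by rewrite !mem_filter /= => /andP[/eqP -> _] /andP[/eqP -> _] ->.
have ht h : gr h (f (h, Posz i))`_i := (poly_comp_coef i (hf (h, Posz i))).1.
rewrite zi; apply: (grading_indep ut ht); last first.
  by apply/mapP; exists (g, z); rewrite // mem_filter ds zi eqxx.
have := congr1 (fun p : {poly A} => p`_i) fs0; rewrite coef0 coef_sum; apply: etrans.
rewrite big_map big_filter big_mkcond /=; apply: eq_bigr => -[h w] _ /=.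
case: eqP => [->//|wi]; apply/esym/eqP.
by apply: contraT => /(poly_comp_coef i (hf (h, w))).2.
Qed.

(* The natural G x Z_{>=0}-grading of A[X], seen as a G x Z-grading. *)
Definition poly_grading : grading (G * int)%type {poly A} :=
  Grading poly_comp_zmod poly_comp_mul poly_comp_span poly_comp_indep.

End PolyGrading.

(* Main.v *)
Require Import Defs.
From HB Require Import structures.
From mathcomp Require Import all_boot all_order all_algebra.
From mathcomp Require Import generic_quotient.
From mathcomp Require Import boolp classical_sets.

(** Write K for the fraction field of A.  Let T be a gr-local graded overring
    of A that satisfies going-down; T must be shown to be a localization of A.
    The idea is to pass to T[X], a graded overring of A[X], apply the hypothesis
    there, and come back by looking at constants.

    The whole transfer rests on the shape of graded ideals for the grading by
    G x Z: every term p_i X^i of a member p of such an ideal I of T[X] is again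
    in I ([graded_term]), so I is controlled by its slice I_0, the graded ideal
    of T formed by the constants of I.

    - T[X] is gr-local ([poly_ext_gr_local]): a proper graded ideal I lies in
      the proper graded ideal I_0 + X T[X], so the graded maximal ideals of T[X]
      are the M + X T[X] with M graded maximal in T.
    - T[X] satisfies going-down ([poly_overring_gGD]): a graded prime P is
      P_0 + X T[X] if it contains X and P_0[X] otherwise
      ([graded_prime_with_X], [graded_prime_without_X]), and the same holds over
      A.  Going-down for T gives a prime of T over P_0; extending it to T[X] by
      the recipe that P obeys gives a prime over P.
    - If T[X] = A[X]_W, every element of W is a unit of T[X], hence a constant,
      since K[X] is a domain.  Comparing constant terms, T is the localization
      of A at W viewed inside A ([poly_overring_localization]).

    The ideals J + X T[X] and J[X] are both of the form
    { p | p_0 in J and p_i in J' for i > 0 }, written [poly_ext phi J J'] below,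
    where phi is an injective morphism out of a polynomial ring.  Taking for phi
    the embedding of K[X] into the fraction field of A[X], or the identity of
    A[X], covers overrings and the base ring at once. *)

Set Implicit Arguments.
Unset Strict Implicit.
Unset Printing Implicit Defensive.

Import GRing.Theory.
Local Open Scope classical_set_scope.
Local Open Scope quotient_scope.
Local Open Scope ring_scope.

(** * Additive subsets and finite sums of components *)

Section AdditiveSets.
Variable L : zmodType.
Implicit Types (I J : set L).

Lemma zmod_setP I :
  zmod_closed (mem I) <-> I 0 /\ forall x y, I x -> I y -> I (x - y).
Proof.
split=> [[/set_mem I0 IB]|[I0 IB]]; split=> //.
- by move=> x y /mem_set Ix /mem_set Iy; apply: set_mem; apply: IB.
- exact: mem_set.
- by move=> x y /set_mem Ix /set_mem Iy; apply: mem_set; apply: IB.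
Qed.

Lemma zmod_set0 I : zmod_closed (mem I) -> I 0.
Proof. by case/zmod_setP. Qed.

Lemma zmod_setB I x y : zmod_closed (mem I) -> I x -> I y -> I (x - y).
Proof. by case/zmod_setP => _; apply. Qed.

Lemma zmod_setD I x y : zmod_closed (mem I) -> I x -> I y -> I (x + y).
Proof.
move=> hI Ix Iy; rewrite -[y]opprK; apply: zmod_setB => //.
by rewrite -sub0r; apply: zmod_setB => //; exact: zmod_set0.
Qed.

Lemma zmod_set_sum I (T : Type) (r : seq T) (F : T -> L) :
  zmod_closed (mem I) -> (forall i, I (F i)) -> I (\sum_(i <- r) F i).
Proof.
move=> hI IF; apply: big_ind => [|x y|i _ //]; first exact: zmod_set0.
exact: zmod_setD.
Qed.

Lemma zmod_set_muln I x n : zmod_closed (mem I) -> I x -> I (x *+ n).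
Proof.
move=> hI Ix; elim: n => [|n IHn]; first by rewrite mulr0n; exact: zmod_set0.
by rewrite mulrS; exact: zmod_setD.
Qed.

Lemma zmod_setI I J : zmod_closed (mem I) -> zmod_closed (mem J) ->
  zmod_closed (mem (I `&` J)).
Proof.
move=> /zmod_setP[I0 IB] /zmod_setP[J0 JB]; apply/zmod_setP; split=> //.
by move=> x y [Ix Jx] [Iy Jy]; split; [exact: IB | exact: JB].
Qed.

Variables (G : zmodType) (D : G -> set L).
Hypothesis D_zmod : forall g, zmod_closed (mem (D g)).

Lemma sum_comp1 g x : D g x -> sum_comp D x.
Proof.
move=> Dx; exists [:: g], (fun h => if h == g then x else 0).
split=> [h|]; last by rewrite big_seq1 eqxx.
by case: eqP => [->//|_]; exact: zmod_set0.
Qed.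

(** The index list of a member of [sum_comp] may have repetitions; they are
    turned into multiplicities over any duplicate-free list containing it. *)
Lemma sum_count_mem (s u : seq G) (f : G -> L) : uniq u -> {subset s <= u} ->
  \sum_(g <- s) f g = \sum_(g <- u) f g *+ count_mem g s.
Proof.
move=> uu; elim: s => [|h s IHs] su.
  by rewrite big_nil big1 // => g _; rewrite mulr0n.
rewrite big_cons IHs => [|g gs]; last by rewrite su // inE gs orbT.
under [RHS]eq_bigr => g _ do rewrite /= mulrnDr.
rewrite big_split /=; congr (_ + _).
rewrite (bigD1_seq h) ?su ?mem_head //= eqxx mulr1n big1 ?addr0 // => g.
by rewrite eq_sym => /negPf ->; rewrite mulr0n.
Qed.

Lemma sum_comp_zmod : zmod_closed (mem (sum_comp D)).
Proof.
apply/zmod_setP; split.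
  by exists [::], (fun=> 0); split=> [g|]; [exact: zmod_set0|rewrite big_nil].
move=> _ _ [s [f [Df ->]]] [t [e [De ->]]].
pose u := undup (s ++ t).
have su : {subset s <= u} by move=> g gs; rewrite mem_undup mem_cat gs.
have tu : {subset t <= u} by move=> g gt; rewrite mem_undup mem_cat gt orbT.
exists u, (fun g => f g *+ count_mem g s - e g *+ count_mem g t); split.
  by move=> g; apply: zmod_setB => //; exact: zmod_set_muln.
by rewrite big_split sumrN /= -!sum_count_mem ?undup_uniq.
Qed.

End AdditiveSets.

Lemma subring_setP (R : nzRingType) (S : set R) : subring_closed (mem S) <->
  [/\ S 1, forall x y, S x -> S y -> S (x - y)
         & forall x y, S x -> S y -> S (x * y)].
Proof.
split=> [[/set_mem S1 SB SM]|[S1 SB SM]]; split=> //.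
- by move=> x y /mem_set Sx /mem_set Sy; apply: set_mem; apply: SB.
- by move=> x y /mem_set Sx /mem_set Sy; apply: set_mem; apply: SM.
- exact: mem_set.
- by move=> x y /set_mem Sx /set_mem Sy; apply: mem_set; apply: SB.
- by move=> x y /set_mem Sx /set_mem Sy; apply: mem_set; apply: SM.
Qed.

Lemma subring_set1 (R : nzRingType) (S : set R) : subring_closed (mem S) -> S 1.
Proof. by case/subring_setP. Qed.

Lemma subring_setM (R : nzRingType) (S : set R) x y :
  subring_closed (mem S) -> S x -> S y -> S (x * y).
Proof. by case/subring_setP => _ _; apply. Qed.

Lemma subring_zmod (R : nzRingType) (S : set R) :
  subring_closed (mem S) -> zmod_closed (mem S).
Proof.
move=> /subring_setP[S1 SB _]; apply/zmod_setP; split=> //.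
by rewrite -(subrr 1); exact: SB.
Qed.

Lemma subring_ideal (R : comNzRingType) (S : set R) :
  subring_closed (mem S) -> ideal S S.
Proof.
move=> hS; split=> //; first exact: subring_zmod.
by move=> a x; exact: subring_setM.
Qed.

Lemma ideal_properP (R : comNzRingType) (S I : set R) : S 1 -> ideal S I ->
  I <> S <-> ~ I 1.
Proof.
move=> S1 hI; split=> [IS I1|nI1 IS]; last by rewrite IS in nI1.
apply: IS; apply/seteqP; split; first exact: ideal_sub hI.
by move=> x Sx; rewrite -[x]mulr1; exact: (ideal_mul hI).
Qed.

(** * Graded ideals of a polynomial ring *)

Section PolyExtension.
Variables (G : zmodType) (K L : comNzRingType).
Variables (c : G -> set K) (c' : G * int -> set L).
Variable phi : {rmorphism {poly K} -> L}.

(** The grading of K[X] by G x Z induced by [c], as in [poly_comp], but for a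
    family [c] that need not span K: below, [c] may consist of the components of
    the graded quotient field. *)
Definition poly_homog (d : G * int) : set {poly K} :=
  match d.2 with
  | Posz n => [set p | exists2 a, c d.1 a & p = a *: 'X^n]
  | Negz _ => [set 0]
  end.

Hypothesis phi_inj : injective phi.
Hypothesis c_zmod : forall g, zmod_closed (mem (c g)).
Hypothesis c'_zmod : forall d, zmod_closed (mem (c' d)).
Hypothesis c'_phi : forall d p, c' d (phi p) <-> poly_homog d p.

Definition poly_ext (J J' : set K) : set L :=
  phi @` [set p : {poly K} | J p`_0 /\ forall i, J' p`_i.+1].

Definition slice0 (I : set L) : set K := [set a | I (phi a%:P)].

Lemma poly_extE J J' p :
  poly_ext J J' (phi p) <-> J p`_0 /\ forall i, J' p`_i.+1.
Proof. by split=> [[q hq /phi_inj <-]//|hp]; exists p. Qed.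

Lemma poly_ext_diagE J p : poly_ext J J (phi p) <-> forall i, J p`_i.
Proof. by rewrite poly_extE; split=> [[J0 JS] [|i]|]. Qed.

Lemma poly_extS I I' J J' : I `<=` J -> I' `<=` J' ->
  poly_ext I I' `<=` poly_ext J J'.
Proof.
move=> IJ IJ' _ [p [I0 IS] <-]; exists p => //.
by split=> [|i]; [exact: IJ | exact: IJ'].
Qed.

Lemma poly_ext_zmod J J' : zmod_closed (mem J) -> zmod_closed (mem J') ->
  zmod_closed (mem (poly_ext J J')).
Proof.
move=> hJ hJ'; apply/zmod_setP; split.
  rewrite -(rmorph0 phi); apply/poly_extE.
  by split=> [|i]; rewrite coef0; exact: zmod_set0.
move=> _ _ [p [p0 pS] <-] [q [q0 qS] <-]; rewrite -rmorphB; apply/poly_extE.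
by split=> [|i]; rewrite coefB; exact: zmod_setB.
Qed.

Lemma slice0_poly_ext J J' : zmod_closed (mem J') ->
  slice0 (poly_ext J J') = J.
Proof.
move=> hJ'; apply/seteqP; split=> a; rewrite /slice0 /= poly_extE coefC /=.
  by case.
by move=> Ja; split=> // i; rewrite coefC; exact: zmod_set0.
Qed.

(** A homogeneous decomposition of each coefficient p_i, multiplied by X^i, is
    one of p_i X^i. *)
Lemma poly_ext_graded J J' : zmod_closed (mem J) -> zmod_closed (mem J') ->
  is_graded c J -> is_graded c J' -> is_graded c' (poly_ext J J').
Proof.
move=> hJ hJ' gJ gJ' _ [p [p0 pS] <-]; rewrite -[p]coefK poly_def rmorph_sum.
have homJ d : zmod_closed (mem (poly_ext J J' `&` c' d)).
  by apply: zmod_setI => //; exact: poly_ext_zmod.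
apply: zmod_set_sum => [|[i /= _]]; first exact: sum_comp_zmod.
have [s [f [hf ->]]] : sum_comp (fun g => (if i == 0 then J else J') `&` c g) p`_i.
  by case: i => [|i]; [exact: gJ | exact: gJ'].
rewrite scaler_suml rmorph_sum; apply: zmod_set_sum => [|g].
  exact: sum_comp_zmod.
have [Jfg cfg] := hf g.
apply: (sum_comp1 homJ (g := (g, Posz i))); split; last first.
  by apply/c'_phi; exists (f g).
apply/poly_extE; split=> [|j]; rewrite coefZ coefXn.
  case: (i) Jfg => [|k] Jfg; first by rewrite mulr1.
  by rewrite mulr0; exact: zmod_set0.
case: (j.+1 =P i) Jfg => [<-|_] Jfg; first by rewrite mulr1.
by rewrite mulr0; exact: zmod_set0.
Qed.

Variable T : set K.
Hypothesis T_subring : subring_closed (mem T).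
Let S := poly_ext T T.

Let T_zmod := subring_zmod T_subring.
Let T1 := subring_set1 T_subring.

Lemma poly_ext_subring : subring_closed (mem S).
Proof.
apply/subring_setP; split.
- rewrite -(rmorph1 phi); apply/poly_ext_diagE => i.
  by rewrite coef1; case: eqP => _; [exact: T1 | exact: zmod_set0].
- by move=> x y; apply: zmod_setB; exact: poly_ext_zmod.
move=> _ _ [p /poly_extE/poly_ext_diagE hp <-] [q /poly_extE/poly_ext_diagE hq <-].
rewrite -rmorphM; apply/poly_ext_diagE => i; rewrite coefM.
by apply: zmod_set_sum => // j; exact: subring_setM.
Qed.

Let S1 : S 1 := subring_set1 poly_ext_subring.

Lemma poly_ext_polyC a : S (phi a%:P) <-> T a.
Proof. by have -> : T a = slice0 S a by rewrite slice0_poly_ext. Qed.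

Lemma poly_ext_Xn n : S (phi 'X^n).
Proof.
apply/poly_ext_diagE => i; rewrite coefXn.
by case: eqP => _; [exact: T1 | exact: zmod_set0].
Qed.

Lemma poly_ext_ideal J J' : ideal T J -> ideal T J' -> J `<=` J' ->
  ideal S (poly_ext J J').
Proof.
move=> hJ hJ' JJ'; split.
- by apply: poly_extS; [exact: ideal_sub hJ | exact: ideal_sub hJ'].
- by apply: poly_ext_zmod; [exact: ideal_zmod hJ | exact: ideal_zmod hJ'].
move=> _ _ [p /poly_extE/poly_ext_diagE hp <-] [q [q0 qS] <-].
rewrite -rmorphM; apply/poly_extE; split=> [|i].
  by rewrite coef0M; exact: (ideal_mul hJ).
rewrite coefM; apply: zmod_set_sum => [|j]; first exact: ideal_zmod hJ'.
apply: (ideal_mul hJ') => //; case: (_ - _)%N => [|k //]; exact: JJ'.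
Qed.

Lemma slice0_ideal I : ideal S I -> ideal T (slice0 I).
Proof.
move=> hI; split.
- by move=> a /(ideal_sub hI)/poly_ext_polyC.
- apply/zmod_setP; split=> [|a b Ia Ib]; rewrite /slice0 /=.
    by rewrite rmorph0; apply: zmod_set0; exact: ideal_zmod hI.
  by rewrite !rmorphB; apply: zmod_setB => //; exact: ideal_zmod hI.
by move=> a x /poly_ext_polyC Ta Ix; rewrite /slice0 /= !rmorphM; exact: (ideal_mul hI).
Qed.

Lemma slice0_proper I : ideal S I -> slice0 I <> T <-> I <> S.
Proof.
move=> hI; rewrite (ideal_properP T1 (slice0_ideal hI)) (ideal_properP S1 hI).
by rewrite /slice0 /= rmorph1.
Qed.

Lemma poly_ext_proper J J' : ideal T J -> ideal T J' -> J `<=` J' ->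
  J <> T -> poly_ext J J' <> S.
Proof.
move=> hJ hJ' JJ' JT; apply/slice0_proper; first exact: poly_ext_ideal.
by rewrite slice0_poly_ext //; exact: ideal_zmod hJ'.
Qed.

(** Homogeneous components are taken in L; because I lies in the image S of
    polynomials and [phi] is injective, they come from homogeneous
    polynomials. *)
Lemma homog_decomp I p : I `<=` S -> is_graded c' I -> I (phi p) ->
  exists (s : seq (G * int)) (q : G * int -> {poly K}),
    p = \sum_(d <- s) q d /\ forall d, I (phi (q d)) /\ poly_homog d (q d).
Proof.
move=> IS gI /gI[s [f [hf pE]]].
have /choice[q hq] d : exists q, phi q = f d.
  by have [/IS[q _ <-] _] := hf d; exists q.
exists s, q; split=> [|d]; last first.
  by have [] := hf d; rewrite -hq => ? /c'_phi.
by apply: phi_inj; rewrite pE rmorph_sum; apply: eq_bigr => d _; rewrite hq.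
Qed.

Lemma poly_homog_term d p i :
  poly_homog d p -> p`_i *: 'X^i = p \/ p`_i = 0.
Proof.
case: d => g [n|n] /=; last by move=> ->; rewrite coef0; right.
move=> [a _ ->]; rewrite coefZ coefXn; case: (i =P n) => [->|_].
  by rewrite mulr1; left.
by rewrite mulr0; right.
Qed.

Lemma poly_homog_coef d p i : poly_homog d p -> c d.1 p`_i.
Proof.
case: d => g [n|n] /=; last by move=> ->; rewrite coef0; exact: zmod_set0.
move=> [a ca ->]; rewrite coefZ coefXn; case: (i =P n) => _.
  by rewrite mulr1.
by rewrite mulr0; exact: zmod_set0.
Qed.

(** The degree in Z of a monomial is its exponent, so the homogeneous
    components of a polynomial that have exponent i add up to its i-th term. *)
Lemma graded_term I p i : ideal S I -> is_graded c' I -> I (phi p) ->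
  I (phi (p`_i *: 'X^i)).
Proof.
move=> hI gI /(homog_decomp (ideal_sub hI) gI)[s [q [-> hq]]].
have zI := ideal_zmod hI.
rewrite coef_sum scaler_suml rmorph_sum; apply: zmod_set_sum => // d.
have [Iq /(@poly_homog_term _ _ i)[->//|->]] := hq d.
by rewrite scale0r rmorph0; exact: zmod_set0.
Qed.

Lemma slice0_graded I : ideal S I -> is_graded c' I -> is_graded c (slice0 I).
Proof.
move=> hI gI a /(homog_decomp (ideal_sub hI) gI)[s [q [aE hq]]].
have zI := ideal_zmod (slice0_ideal hI).
have homI g : zmod_closed (mem (slice0 I `&` c g)) by exact: zmod_setI.
have -> : a = \sum_(d <- s) (q d)`_0 by rewrite -coef_sum -aE coefC.
apply: zmod_set_sum => [|d]; first exact: sum_comp_zmod.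
apply: (sum_comp1 homI (g := d.1)); have [Iq hom] := hq d.
split; last exact: poly_homog_coef hom.
have [e|->] := poly_homog_term 0 hom; last exact: zmod_set0.
by rewrite /slice0 /= -[_%:P]mulr1 mul_polyC -(expr0 'X) e.
Qed.

(** ** The graded maximal ideal *)

Lemma sub_poly_ext_slice0 I : ideal S I -> is_graded c' I ->
  I `<=` poly_ext (slice0 I) T.
Proof.
move=> hI gI x Ix; have [p /poly_extE/poly_ext_diagE Tp xE] := ideal_sub hI Ix.
rewrite -xE in Ix *; apply/poly_extE; split=> //.
by have := graded_term 0 hI gI Ix; rewrite expr0 alg_polyC.
Qed.

(** Extending J to J + X T[X] and slicing both preserve proper graded ideals
    and inclusions, and a graded ideal is contained in the extension of its
    slice; hence graded maximal ideals correspond. *)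
Lemma poly_ext_gr_local : is_graded c T -> gr_local c T -> gr_local c' S.
Proof.
move=> gT [M [[[hM gM MT] maxM] uniqM]].
have hT := subring_ideal T_subring; have MsubT := ideal_sub hM.
have maxext J : proper_graded_ideal c T J ->
    proper_graded_ideal c' S (poly_ext J T).
  move=> [hJ gJ JT]; have sJT := ideal_sub hJ.
  split; [exact: poly_ext_ideal | | exact: poly_ext_proper].
  by apply: poly_ext_graded => //; exact: ideal_zmod hJ.
have slice I : proper_graded_ideal c' S I -> proper_graded_ideal c T (slice0 I).
  move=> [hI gI IS].
  split; [exact: slice0_ideal | exact: slice0_graded | exact/slice0_proper].
exists (poly_ext M T); split.
  split=> [|I pI sub]; first exact: maxext.
  have [hI gI _] := pI; apply/seteqP; split=> //.
  rewrite -(maxM _ (slice _ pI)); first exact: sub_poly_ext_slice0.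
  by move=> a Ma; apply: sub; rewrite -[M](slice0_poly_ext M T_zmod) in Ma.
move=> I [pI maxI]; have [hI gI _] := pI.
have eI : poly_ext (slice0 I) T = I.
  by apply: maxI; [exact/maxext/slice | exact: sub_poly_ext_slice0].
rewrite -eI (uniqM (slice0 I)) //; split; first exact: slice.
move=> J pJ sub; have [hJ _ _] := pJ.
rewrite -(slice0_poly_ext J T_zmod) (maxI (poly_ext J T)) //.
  exact: maxext.
by rewrite -eI; apply: poly_extS.
Qed.

(** ** Graded primes *)

Lemma slice0_prime P : prime_ideal S P -> prime_ideal T (slice0 P).
Proof.
move=> [hP PS mulP]; split; [exact: slice0_ideal | exact/slice0_proper |].
move=> a b /poly_ext_polyC Sa /poly_ext_polyC Sb; rewrite /slice0 /= !rmorphM.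
exact: mulP.
Qed.

Lemma slice0_hSpec P : hSpec c' S P -> hSpec c T (slice0 P).
Proof.
move=> [pP gP]; split; first exact: slice0_prime.
by apply: slice0_graded => //; exact: prime_is_ideal pP.
Qed.

(** J + X T[X] is the preimage of J under the morphism p |-> p_0. *)
Lemma poly_ext_T_prime J : prime_ideal T J -> prime_ideal S (poly_ext J T).
Proof.
move=> [hJ JT mulJ]; have hT := subring_ideal T_subring.
have sJT := ideal_sub hJ.
split; [exact: poly_ext_ideal | exact: poly_ext_proper |].
move=> _ _ [p [p0 pS] <-] [q [q0 qS] <-]; rewrite -rmorphM !poly_extE coef0M.
by move=> [/(mulJ _ _ p0 q0)[] ? _]; [left | right].
Qed.

(** Gauss's argument: if p_m and q_n are the first coefficients outside J, then
    p_m q_n is the only term of the (m+n)-th coefficient of pq outside J. *)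
Lemma poly_ext_diag_prime J : prime_ideal T J -> prime_ideal S (poly_ext J J).
Proof.
move=> [hJ JT mulJ]; have zJ := ideal_zmod hJ.
split; [exact: poly_ext_ideal | exact: poly_ext_proper |].
move=> _ _ [p /poly_extE/poly_ext_diagE Tp <-]
  [q /poly_extE/poly_ext_diagE Tq <-].
rewrite -rmorphM !poly_ext_diagE => Jpq.
have least (r : {poly K}) : ~ (forall i, J r`_i) ->
    exists2 m, ~ J r`_m & forall i, (i < m)%N -> J r`_i.
  move=> /existsNP hr.
  have ex : exists i, `[< ~ J r`_i >] by have [i ?] := hr; exists i; apply/asboolP.
  case: (ex_minnP ex) => m /asboolP nJ min; exists m => // i im.
  by apply: contrapT => /asboolP/min; rewrite leqNgt im.
have [Jp|/least[m nJm ltm]] := pselect (forall i, J p`_i); first by left.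
have [Jq|/least[n nJn ltn]] := pselect (forall i, J q`_i); first by right.
have mi : (m < (m + n).+1)%N by rewrite ltnS leq_addr.
case: (mulJ p`_m q`_n) => //.
have := Jpq (m + n)%N; rewrite coefM (bigD1 (Ordinal mi)) //= addKn => Jsum.
rewrite -[_ * _](addrK (\sum_(i < (m + n).+1 | i != Ordinal mi)
  p`_i * q`_(m + n - i))).
apply: zmod_setB => //; rewrite big_mkcond /=; apply: zmod_set_sum => // i.
case: ifP => [ne|_]; last exact: zmod_set0.
have [im|mle] := ltnP i m; first by rewrite mulrC; apply: (ideal_mul hJ) => //; exact: ltm.
apply: (ideal_mul hJ) => //; apply: ltn.
have {}mle : (m < i)%N by rewrite ltn_neqAle mle andbT eq_sym.
by rewrite ltn_subLR ?ltn_add2r // -ltnS ltn_ord.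
Qed.

Lemma poly_ext_T_hSpec J : is_graded c T -> hSpec c T J ->
  hSpec c' S (poly_ext J T).
Proof.
move=> gT [pJ gJ]; split; first exact: poly_ext_T_prime.
by apply: poly_ext_graded => //; exact: ideal_zmod (prime_is_ideal pJ).
Qed.

Lemma poly_ext_diag_hSpec J : hSpec c T J -> hSpec c' S (poly_ext J J).
Proof.
move=> [pJ gJ]; split; first exact: poly_ext_diag_prime.
by apply: poly_ext_graded => //; exact: ideal_zmod (prime_is_ideal pJ).
Qed.

Lemma poly_ext_slice0_sub P : ideal S P ->
  poly_ext (slice0 P) (slice0 P) `<=` P.
Proof.
move=> hP _ [p /poly_extE/poly_ext_diagE Pp <-].
rewrite -[p]coefK poly_def rmorph_sum; apply: zmod_set_sum => [|i].
  exact: ideal_zmod hP.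
by rewrite -mul_polyC mulrC rmorphM; exact: (ideal_mul hP (poly_ext_Xn _) (Pp i)).
Qed.

Lemma poly_ext_slice0_T_sub P : ideal S P -> P (phi 'X) ->
  poly_ext (slice0 P) T `<=` P.
Proof.
move=> hP PX _ [p [P0 Tp] <-]; have zP := ideal_zmod hP.
rewrite -[p]coefK poly_def rmorph_sum; apply: zmod_set_sum => [//|[[|i] _] /=].
  by rewrite expr0 alg_polyC.
rewrite exprSr -mul_polyC mulrA rmorphM; apply: (ideal_mul hP) => //.
rewrite rmorphM; apply: subring_setM; first exact: poly_ext_subring.
  exact/poly_ext_polyC.
exact: poly_ext_Xn.
Qed.

Lemma graded_prime_with_X P : hSpec c' S P -> P (phi 'X) ->
  P = poly_ext (slice0 P) T.
Proof.
move=> [[hP _ _] gP] PX; apply/seteqP; split; first exact: sub_poly_ext_slice0.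
exact: poly_ext_slice0_T_sub.
Qed.

(** A term p_i X^i of a member of P lies in P, and the prime P does not
    contain X^i, so it contains p_i. *)
Lemma graded_prime_without_X P : hSpec c' S P -> ~ P (phi 'X) ->
  P = poly_ext (slice0 P) (slice0 P).
Proof.
move=> [[hP PS mulP] gP] PX; apply/seteqP; split; last first.
  exact: poly_ext_slice0_sub.
have PXn n : ~ P (phi 'X^n).
  elim: n => [|n IHn].
    by rewrite expr0 rmorph1; apply/(ideal_properP S1 hP).
  by rewrite exprS rmorphM => /(mulP _ _ (poly_ext_Xn 1) (poly_ext_Xn n))[].
move=> x Px; have [p /poly_extE/poly_ext_diagE Tp xE] := ideal_sub hP Px.
rewrite -xE in Px *; apply/poly_ext_diagE => i.
have := graded_term i hP gP Px; rewrite -mul_polyC rmorphM.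
by move=> /(mulP _ _ _ (poly_ext_Xn i))[|//|/PXn]; first exact/poly_ext_polyC.
Qed.

End PolyExtension.

(** * The graded quotient field *)

Lemma denom_repr_neq0 (R : idomainType) (x : {fraction R}) :
  \d_(repr x) != 0.
Proof. exact: denom_ratioP. Qed.

Lemma frac_repr (R : idomainType) (x : {fraction R}) :
  x = tofrac \n_(repr x) / tofrac \d_(repr x).
Proof.
have d0 : tofrac \d_(repr x) != 0 by rewrite tofrac_eq0 denom_repr_neq0.
apply: (mulIf d0); rewrite divfK // -[x in x * _]reprK.
unlock FracField.tofrac; rewrite -[LHS]FracField.pi_mul.
apply/eqmodP; rewrite /= FracField.equivfE /FracField.mulf /=.
by rewrite !numden_Ratio ?mulr1 ?oner_neq0 ?denom_repr_neq0 // mulrC.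
Qed.

Lemma fracP (R : idomainType) (x : {fraction R}) :
  exists a b, b != 0 /\ x = tofrac a / tofrac b.
Proof.
by exists \n_(repr x), \d_(repr x); rewrite denom_repr_neq0 -frac_repr.
Qed.

Section GradedQuotientField.
Variables (G : zmodType) (R : idomainType) (gr : grading G R).

(** 1 is a sum of homogeneous elements, so these cannot all be 0. *)
Lemma gr_neq0 : exists g h, gr g h /\ h <> 0.
Proof.
have [s [f [hf]]] : sum_comp gr 1 by rewrite grading_span.
apply: contraPP => /forallNP none; rewrite big1 => [|g _]; first exact/eqP/oner_neq0.
by apply: contrapT => fg0; apply: (none g); exists (f g).
Qed.

(** The fraction 0/h has every degree, once some nonzero homogeneous h is
    available to choose the degree of the numerator accordingly. *)
Lemma qf_comp0 d : qf_comp gr d 0.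
Proof.
have [g [h [grh h0]]] := gr_neq0; exists (d + g), g, 0, h.
by split; [exact: gr0 | | | rewrite tofrac0 mul0r | rewrite addrK].
Qed.

Lemma qf_comp_zmod d : zmod_closed (mem (qf_comp gr d)).
Proof.
apply/zmod_setP; split; first exact: qf_comp0.
move=> _ _ [a [b [f [h [grf grh /eqP h0 -> ->]]]]]
  [a' [b' [f' [h' [grf' grh' /eqP h0' -> e]]]]].
exists (a + b'), (b + b'), (f * h' - f' * h), (h * h').
split.
- apply: grB; first exact: grading_mul.
  have -> : a + b' = a' + b by rewrite -[a](subrK b) e addrAC subrK.
  exact: grading_mul.
- exact: grading_mul.
- by apply/eqP; rewrite mulf_neq0.
- by rewrite tofracB !tofracM -mulNr addf_div ?tofrac_eq0 // mulNr.
by rewrite opprD addrACA subrr addr0.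
Qed.

Lemma gr_quotient_field_zmod : zmod_closed (mem (gr_quotient_field gr)).
Proof.
apply/zmod_setP; split.
  by have [g [h [grh h0]]] := gr_neq0; exists 0, h; split;
    [split=> //; exists g | rewrite tofrac0 mul0r].
move=> _ _ [r [h [[/eqP h0 [g grh]] ->]]] [r' [h' [[/eqP h0' [g' grh']] ->]]].
exists (r * h' - r' * h), (h * h'); split.
  split; first by apply/eqP; rewrite mulf_neq0.
  by exists (g + g'); exact: grading_mul.
by rewrite tofracB !tofracM -mulNr addf_div ?tofrac_eq0 // mulNr.
Qed.

(** Homogeneous fractions have homogeneous denominators, and sums of fractions
    with homogeneous denominators are again of this kind. *)
Lemma graded_sub_quotient_field (S : set {fraction R}) :
  is_graded (qf_comp gr) S -> S `<=` gr_quotient_field gr.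
Proof.
move=> gS _ /gS[s [f [hf ->]]].
apply: zmod_set_sum => [|g]; first exact: gr_quotient_field_zmod.
have [_ [a [b [r [h [_ grh h0 -> _]]]]]] := hf g.
by exists r, h; split=> //; split=> //; exists b.
Qed.

End GradedQuotientField.

(** * Polynomials over the fraction field as fractions of polynomials *)

Section FractionPolynomials.
Variable A : idomainType.
Local Notation K := {fraction A}.
(** The integral domain structure of {poly A} is named explicitly so that F is
    syntactically the type in which the graded quotient field of [poly_grading]
    lives. *)
Local Notation F := (FracField.type [the idomainType of {poly A}]).

(** The embedding of K into F induced by the constants of A[X]; it is read off
    a chosen representative, and [frac_polyC_div] shows that the choice is
    immaterial. *)
Definition frac_polyC (x : K) : F :=
  tofrac (\n_(repr x))%:P / tofrac (\d_(repr x))%:P.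

Lemma frac_polyC_div a b : b != 0 ->
  frac_polyC (tofrac a / tofrac b) = tofrac a%:P / tofrac b%:P.
Proof.
move=> b0; rewrite /frac_polyC; set x : K := tofrac a / tofrac b.
have d0 := denom_repr_neq0 x.
apply/eqP; rewrite eqr_div ?tofrac_eq0 ?polyC_eq0 // -!tofracM -!polyCM.
have /eqP : x = tofrac \n_(repr x) / tofrac \d_(repr x) by exact: frac_repr.
rewrite {1}/x eqr_div ?tofrac_eq0 // -!tofracM tofrac_eq => /eqP <-.
by [].
Qed.

Lemma frac_polyC_tofrac a : frac_polyC (tofrac a) = tofrac a%:P.
Proof.
by rewrite -[tofrac a]divr1 -tofrac1 frac_polyC_div ?oner_neq0 // tofrac1 divr1.
Qed.

Lemma frac_polyC_zmod : zmod_morphism frac_polyC.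
Proof.
move=> x y; have [a [b [b0 ->]]] := fracP x; have [c [d [d0 ->]]] := fracP y.
rewrite -mulNr addf_div ?tofrac_eq0 // mulNr -!tofracM -tofracB.
rewrite !frac_polyC_div ?mulf_neq0 // polyCB !polyCM tofracB !tofracM.
by rewrite -mulNr -[- (_ / _)]mulNr addf_div ?tofrac_eq0 ?polyC_eq0.
Qed.

Lemma frac_polyC_monoid : monoid_morphism frac_polyC.
Proof.
split; first by rewrite -tofrac1 frac_polyC_tofrac tofrac1.
move=> x y; have [a [b [b0 ->]]] := fracP x; have [c [d [d0 ->]]] := fracP y.
rewrite mulf_div -!tofracM !frac_polyC_div ?mulf_neq0 //.
by rewrite !polyCM !tofracM mulf_div.
Qed.

HB.instance Definition _ :=
  GRing.isZmodMorphism.Build K F frac_polyC frac_polyC_zmod.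
HB.instance Definition _ :=
  GRing.isMonoidMorphism.Build K F frac_polyC frac_polyC_monoid.

Definition frac_poly : {poly K} -> F :=
  horner_eval (tofrac 'X) \o map_poly frac_polyC.

HB.instance Definition _ := GRing.RMorphism.on frac_poly.

Lemma frac_polyE_C a : frac_poly a%:P = frac_polyC a.
Proof. by rewrite /frac_poly /= map_polyC /horner_eval hornerC. Qed.

Lemma frac_polyE_X : frac_poly 'X = tofrac 'X.
Proof. by rewrite /frac_poly /= map_polyX /horner_eval hornerX. Qed.

Lemma frac_poly_map (q : {poly A}) : frac_poly (map_poly (@tofrac A) q) = tofrac q.
Proof.
elim/poly_ind: q => [|q c IHq]; first by rewrite !rmorph0.
rewrite !rmorphD !rmorphM /= map_polyX map_polyC /= IHq.
by rewrite frac_polyE_X frac_polyE_C frac_polyC_tofrac.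
Qed.

Lemma common_denominator (p : {poly K}) :
  exists (d : A) (q : {poly A}), d != 0 /\ tofrac d *: p = map_poly (@tofrac A) q.
Proof.
elim/poly_ind: p => [|p x [d [q [d0 dp]]]].
  by exists 1, 0; rewrite oner_neq0 rmorph0 scaler0.
have [a [b [b0 ->]]] := fracP x.
exists (b * d), (b%:P * q * 'X + (d * a)%:P); split; first by rewrite mulf_neq0.
rewrite !rmorphD !rmorphM /= !map_polyC map_polyX /= -dp.
rewrite -!mul_polyC -!polyCM mulrDr -polyCM.
have -> : tofrac b * tofrac d * (tofrac a / tofrac b) = tofrac d * tofrac a.
  by rewrite -mulrA mulrC -!mulrA mulVf ?mulr1 ?tofrac_eq0.
by rewrite (polyCM (tofrac b)) !mulrA.
Qed.

(** After multiplication by a common denominator the claim is about a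
    polynomial over A, where [frac_poly] is the embedding [tofrac]. *)
Lemma frac_poly_inj : injective frac_poly.
Proof.
apply: raddf_inj => p p0; have [d [q [d0 dp]]] := common_denominator p.
have /eqP : tofrac q = 0 by rewrite -frac_poly_map -dp -mul_polyC rmorphM p0 mulr0.
rewrite tofrac_eq0 => /eqP q0; move/eqP: dp.
by rewrite q0 rmorph0 scaler_eq0 tofrac_eq0 (negPf d0) => /eqP.
Qed.

Variables (G : zmodType) (gr : grading G A).

(** A polynomial p over K equal to the quotient of homogeneous a X^n and b X^m
    satisfies p (b X^m) = a X^n, so p is the monomial (a/b) X^(n-m), of
    nonnegative exponent unless p = 0. *)
Lemma qf_comp_frac_poly d p :
  qf_comp (poly_grading gr) d (frac_poly p) <-> poly_homog (qf_comp gr) d p.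
Proof.
case: d => g z; split; last first.
  case: z => n /=; last by move=> ->; rewrite rmorph0; exact: qf_comp0.
  move=> [_ [u [v [f [h [grf grh /eqP h0 -> /= ->]]]]] ->].
  exists (u, Posz n), (v, Posz 0), (f *: 'X^n), h%:P.
  split; [by exists f | by exists h => //; rewrite expr0 alg_polyC | | | ].
  - by apply/eqP; rewrite polyC_eq0.
  - rewrite -mul_polyC rmorphM /= frac_polyE_C frac_polyC_div // rmorphXn /=.
    by rewrite frac_polyE_X -mul_polyC tofracM tofracXn mulrAC.
  by congr (_, _); rewrite /= subr0.
move=> [[u zu] [[v zv] [f [h [hf hh /eqP h0 pE [-> ->]]]]]].
have [-> | p0] := eqVneq p 0.
  case: (zu - zv) => n; last by [].
  by exists 0; rewrite ?scale0r //; exact: qf_comp0.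
case: zv hh => m /=; last by move=> hh; rewrite hh eqxx in h0.
move=> [b grb hE].
have b0 : b != 0 by apply: contraNneq h0 => b0; rewrite hE b0 scale0r.
have fE : p * map_poly (@tofrac A) h = map_poly (@tofrac A) f.
  apply: frac_poly_inj; rewrite rmorphM /= !frac_poly_map.
  by rewrite pE divfK ?tofrac_eq0.
case: zu hf => n /=; last first.
  move=> f0; move/eqP: fE; rewrite f0 rmorph0 mulf_eq0 (negPf p0) /=.
  by rewrite -(inj_eq frac_poly_inj) rmorph0 frac_poly_map tofrac_eq0 (negPf h0).
move=> [a gra fa].
have pj j : p`_j = tofrac a / tofrac b * (j + m == n)%:R.
  have := congr1 (fun r : {poly K} => r`_(j + m)) fE.
  rewrite hE fa -!mul_polyC !rmorphM /= !map_polyC !map_polyXn /=.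
  rewrite mulrCA !coefCM coefMXn ltnNge leq_addl /= addnK coefXn mulrC => e.
  by rewrite mulrAC -e mulfK ?tofrac_eq0.
have mn : (m <= n)%N.
  rewrite leqNgt; apply: contra p0 => nm; apply/eqP/polyP => j.
  rewrite pj coef0; case: eqP => [e|]; last by rewrite mulr0.
  by move: nm; rewrite -e ltnNge leq_addl.
rewrite subzn //; exists (tofrac a / tofrac b).
  by exists u, v, a, b; split=> //; exact/eqP.
apply/polyP => j; rewrite pj coefZ coefXn.
by rewrite -[in LHS](subnK mn) eqn_add2r.
Qed.

End FractionPolynomials.

(** * Polynomial rings over graded overrings *)

Section PolynomialOverring.
Variables (G : zmodType) (A : idomainType) (gr : grading G A).
Variable T : set {fraction A}.
Hypothesis T_overring : graded_overring gr T.

Let polyT := poly_ext (@frac_poly A) T T.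

Let T_subring := overring_subring T_overring.
Let T_graded := overring_graded T_overring.

Lemma contraction_overring : contraction T = setT.
Proof.
by apply/seteqP; split=> // a _; apply: (overring_base T_overring); exists a.
Qed.

Lemma contraction_poly_ext (J J' : set {fraction A}) :
  contraction (poly_ext (@frac_poly A) J J') =
  poly_ext (@idfun {poly A}) (contraction J) (contraction J').
Proof.
apply/funext => p; apply/propext; rewrite (poly_extE (phi := idfun)) //.
rewrite /contraction /preimage /= -frac_poly_map.
rewrite (poly_extE (@frac_poly_inj A)) coef_map.
by split=> -[J0 JS]; split=> // i; have := JS i; rewrite coef_map.
Qed.

Lemma contraction_slice0 (I : set {fraction {poly A}}) :
  contraction (slice0 (@frac_poly A) I) = slice0 (@idfun {poly A}) (contraction I).
Proof.
apply/funext => a.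
by rewrite /contraction /slice0 /preimage /= frac_polyE_C frac_polyC_tofrac.
Qed.

Lemma setT_poly_ext : setT = poly_ext (@idfun {poly A}) setT setT.
Proof. by apply/seteqP; split=> // p _; exists p. Qed.

Lemma poly_grading_homog d (p : {poly A}) :
  poly_grading gr d (@idfun {poly A} p) <-> poly_homog gr d p.
Proof. by []. Qed.

Lemma setT_subring : subring_closed (mem [set: A]).
Proof. by apply/subring_setP; split. Qed.

Lemma poly_overring : graded_overring (poly_grading gr) polyT.
Proof.
have gS : is_graded (qf_comp (poly_grading gr)) polyT.
  apply: (poly_ext_graded (@frac_poly_inj A) (qf_comp_zmod _)
    (qf_comp_frac_poly gr)) => //; exact: subring_zmod.
split=> //; last exact: graded_sub_quotient_field.
  by apply: poly_ext_subring T_subring; exact: frac_poly_inj.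
move=> _ [p _ <-].
have : contraction polyT p; last by [].
by rewrite contraction_poly_ext contraction_overring -setT_poly_ext.
Qed.

Lemma poly_overring_gr_local :
  gr_local (qf_comp gr) T -> gr_local (qf_comp (poly_grading gr)) polyT.
Proof.
exact: (poly_ext_gr_local (@frac_poly_inj A) (qf_comp_zmod _) (qf_comp_zmod _)
  (qf_comp_frac_poly gr) T_subring T_graded).
Qed.

(** The prime over P is built from a prime of T over the slice of P, as
    J + X T[X] or J[X] according to whether X is in P.  In the first case X is
    also in Q, hence in the prime Q' over Q, which therefore contains X T[X]. *)
Lemma poly_overring_gGD : gGD gr T -> gGD (poly_grading gr) polyT.
Proof.
move=> gdT P Q Q' hP hQ hQ' PQ cQ.
have injF := @frac_poly_inj A.
have injP : injective (@idfun {poly A}) by exact: inj_id.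
have czA := grading_zmod gr.
have czK := qf_comp_zmod gr; have czF := qf_comp_zmod (poly_grading gr).
have homF := qf_comp_frac_poly gr.
have sA := setT_subring.
rewrite setT_poly_ext in hP hQ.
have hP0 := slice0_hSpec injP czA poly_grading_homog sA hP.
have hQ0 := slice0_hSpec injP czA poly_grading_homog sA hQ.
have hQ'0 := slice0_hSpec injF czK homF T_subring hQ'.
have [|| P0' [hP0' P0'Q' cP0']] := gdT _ _ _ hP0 hQ0 hQ'0.
- by move=> a; exact: PQ.
- by rewrite contraction_slice0 cQ.
have [[idealQ' _ _] _] := hQ'.
have [PX|PX] := pselect (P 'X).
  exists (poly_ext (@frac_poly A) P0' T); split.
  - exact: (poly_ext_T_hSpec injF czF homF T_subring T_graded hP0').
  - have Q'X : Q' (frac_poly 'X).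
      by rewrite frac_polyE_X; have := PQ _ PX; rewrite -cQ.
    apply: subset_trans (poly_ext_slice0_T_sub injF T_subring idealQ' Q'X).
    exact: poly_extS.
  rewrite contraction_poly_ext cP0' contraction_overring.
  exact/esym/(graded_prime_with_X injP poly_grading_homog sA hP PX).
exists (poly_ext (@frac_poly A) P0' P0'); split.
- exact: (poly_ext_diag_hSpec injF czF homF T_subring hP0').
- apply: subset_trans (poly_ext_slice0_sub injF T_subring idealQ').
  exact: poly_extS.
rewrite contraction_poly_ext cP0'.
exact/esym/(graded_prime_without_X injP poly_grading_homog sA hP PX).
Qed.

(** Inverses of elements of W lie in T[X], so W consists of constants. *)
Lemma poly_overring_localization (W : set {poly A}) :
  multiplicative_subset W -> polyT = localization W ->
  exists W' : set A, multiplicative_subset W' /\ T = localization W'.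
Proof.
move=> [[/set_mem W1 WM] W0] SW; exists [set a | W a%:P]; split.
  split; last by rewrite /= polyC0.
  split; first exact/mem_set.
  move=> a b /set_mem Wa /set_mem Wb; apply: mem_set; rewrite /= polyCM.
  by apply: set_mem; apply: WM; exact: mem_set.
have polyTC x : polyT (frac_poly x%:P) <-> T x.
  exact: (poly_ext_polyC (@frac_poly_inj A) T_subring).
have nz w : W w -> w != 0 by move=> Ww; apply: contraPneq Ww => ->.
have const w : W w -> exists2 a, a != 0 & w = a%:P.
  move=> Ww; have w0 := nz _ Ww.
  have [q _ qE] : polyT ((tofrac w)^-1).
    by rewrite SW; exists 1, w; rewrite tofrac1 mul1r.
  (* In the domain K[X], the factors of 1 are constants. *)
  have wq : map_poly (@tofrac A) w * q = 1.
    apply: frac_poly_inj; rewrite rmorphM rmorph1 /= frac_poly_map qE mulfV //.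
    by rewrite tofrac_eq0.
  have := congr1 (fun p : {poly _} => size p) wq.
  rewrite /= size_poly1 => /eqP; rewrite size_mul_eq1 => /andP[sw _].
  move: sw; rewrite size_map_inj_poly ?tofrac0 //; last first.
    by move=> a b /eqP; rewrite tofrac_eq => /eqP.
  by move=> /size_poly1P[a a0 wE]; exists a.
apply/seteqP; split=> [x Tx | _ [r [a [Wa ->]]]].
  have [r [w [Ww xE]]] : localization W (frac_poly x%:P).
    by rewrite -SW; exact/polyTC.
  have [a a0 wE] := const _ Ww; rewrite {}wE in Ww xE.
  exists r`_0, a; split=> //.
  have xa : (x * tofrac a)%:P = map_poly (@tofrac A) r.
    apply: frac_poly_inj; rewrite frac_poly_map polyCM rmorphM /= xE.
    rewrite frac_polyE_C frac_polyC_tofrac divfK //.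
    by rewrite tofrac_eq0 polyC_eq0.
  have := congr1 (fun p : {poly _} => p`_0) xa.
  by rewrite coefC /= coef_map /= => <-; rewrite mulfK ?tofrac_eq0.
have a0 : a != 0 by rewrite -(polyC_eq0 a) nz.
apply/polyTC; rewrite SW frac_polyE_C frac_polyC_div //.
by exists r%:P, a%:P; split.
Qed.

End PolynomialOverring.

Theorem proposition2p35 (G : zmodType) (hG : torsion_free G)
    (A : idomainType) (gr : grading G A) :
  graded_perinormal (poly_grading gr) -> graded_perinormal gr.
Proof.
move=> perinormal T overT localT gdT.
have [W [mulW SW]] := perinormal _ (poly_overring overT)
  (poly_overring_gr_local overT localT) (poly_overring_gGD overT gdT).
exact: (poly_overring_localization overT mulW SW).
Qed.
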